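(* Let $Q$ be a strong commutative semicartesian quantale and $X$ a $Q$-set. Let $i:\mathbf{ScottQSet}\hookrightarrow\mathbf{QSet}_f$ be the full inclusion and $\mathfrak{S}:\mathbf{QSet}_f\to\mathbf{ScottQSet}$ the Scott completion functor. Then $X$ is Scott-complete if and only if there is a natural isomorphism of presheaves on $\mathbf{QSet}_f$ $$\mathbf{QSet}_f(-,X)\;\cong\;\mathbf{QSet}_f(i\circ\mathfrak{S}(-),X).$$
   Context: A quantale is a complete lattice $(Q,\le)$ with an associative binary operation $\otimes$ that distributes over arbitrary suprema in each variable. It is commutative if $\otimes$ is commutative; semicartesian if $a\otimes b\le a\wedge b$ for all $a,b$; strong if for every $e\in Q$ with $e=e\otimes e$ and every $A\subseteq Q$, $e\le\bigvee_{a\in A}a$ implies $e\le\bigvee_{a\in A}a\otimes a$. A $Q$-set is a set $X$ with a map $\delta:X\times X\to Q$ such that for all $x,y,z$: $\delta(x,y)=\delta(y,x)$; $\delta(x,y)\otimes\delta(y,z)\le\delta(x,z)$; $\delta(x,x)\otimes\delta(x,y)=\delta(x,y)$. The extent of $x$ is $Ex:=\delta(x,x)$. $\mathbf{QSet}_f$ is the category of $Q$-sets with functional morphisms: functions $f:X\to Y$ with $\delta(x,x')\le\delta(f(x),f(x'))$ and $Ef(x)=Ex$, composed as functions. A singleton on $X$ is a map $\sigma:X\to Q$ such that for all $x,y\in X$: $\sigma(x)\otimes Ex=\sigma(x)$; $\sigma(x)\otimes\delta(x,y)\le\sigma(y)$; $\sigma(x)\otimes\sigma(y)\le\delta(x,y)$;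 $\sigma(x)\otimes\bigvee_{y\in X}\sigma(y)=\sigma(x)$. An element $x_\sigma\in X$ represents $\sigma$ if $\sigma(y)=\delta(y,x_\sigma)$ for all $y\in X$. $X$ is Scott-complete if every singleton on $X$ has exactly one representing element. $\mathbf{ScottQSet}$ is the full subcategory of $\mathbf{QSet}_f$ on Scott-complete $Q$-sets. $\mathfrak{S}(X)$ is the set of singletons on $X$ with $\delta(\sigma,\xi)=\bigvee_{x\in X}\sigma(x)\otimes\xi(x)$; for strong $Q$ this is a Scott-complete $Q$-set. For a functional morphism $f:X\to Y$, $\mathfrak{S}(f)(\xi)=\bigvee_{x\in X}\delta(f(x),-)\otimes\xi(x)$; this makes $\mathfrak{S}$ a functor $\mathbf{QSet}_f\to\mathbf{ScottQSet}$. *)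

(* Defs.v *)
From HB Require Import structures.
From mathcomp Require Import all_boot all_order.
From mathcomp Require Import boolp classical_sets.

Set Implicit Arguments.
Unset Strict Implicit.
Unset Printing Implicit Defensive.

Import Order.TTheory.
Local Open Scope order_scope.
Local Open Scope classical_set_scope.

(* A lattice with suprema of all subsets, the empty one included, is a
   complete lattice. *)
HB.mixin Record isCompleteLattice d T of Order.Lattice d T := {
  qsup : set T -> T;
  qsup_ub : forall (A : set T) (a : T), A a -> a <= qsup A;
  qsup_le : forall (A : set T) (b : T),
    (forall a, A a -> a <= b) -> qsup A <= b
}.

#[short(type="completeLatticeType")]
HB.structure Definition CompleteLattice d :=
  { T of Order.Lattice d T & isCompleteLattice d T }.

HB.mixin Record isQuantale d T of CompleteLattice d T := {
  qmul : T -> T -> T;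
  qmulA : associative qmul;
  qmul_supl : forall (A : set T) (b : T),
    qmul (qsup A) b = qsup [set qmul a b | a in A];
  qmul_supr : forall (b : T) (A : set T),
    qmul b (qsup A) = qsup [set qmul b a | a in A]
}.

#[short(type="quantaleType")]
HB.structure Definition Quantale d :=
  { T of CompleteLattice d T & isQuantale d T }.

Notation "a ⊗ b" := (qmul a b) (at level 40, left associativity).
Notation "⋁_ x F" := (qsup (range (fun x => F)))
  (at level 41, x name, F at level 41, format "⋁_ x  F").

Definition commutative_quantale d (Q : quantaleType d) : Prop :=
  forall a b : Q, a ⊗ b = b ⊗ a.

Definition semicartesian_quantale d (Q : quantaleType d) : Prop :=
  forall a b : Q, a ⊗ b <= (a `&` b)%O.

Definition strong_quantale d (Q : quantaleType d) : Prop :=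
  forall (e : Q) (A : set Q), e = e ⊗ e ->
    e <= qsup A -> e <= qsup [set a ⊗ a | a in A].

Section QuantaleTheory.
Context d (Q : quantaleType d).
Implicit Types a b c : Q.

Lemma sup_ub (I : Type) (F : I -> Q) i : F i <= ⋁_x (F x).
Proof. by apply: qsup_ub; exists i. Qed.

Lemma sup_le (I : Type) (F : I -> Q) b :
  (forall i, F i <= b) -> ⋁_x (F x) <= b.
Proof. by move=> h; apply: qsup_le => _ [i _ <-]. Qed.

Lemma eq_sup (I : Type) (F G : I -> Q) :
  (forall i, F i = G i) -> ⋁_x (F x) = ⋁_x (G x).
Proof. by move=> /funext ->. Qed.

Lemma mul_supl (I : Type) (F : I -> Q) b :
  (⋁_x (F x)) ⊗ b = ⋁_x (F x ⊗ b).
Proof.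
rewrite qmul_supl; congr qsup; apply/seteqP; split => [_ [_ [i _ <-] <-]|_ [i _ <-]].
  by exists i.
by exists (F i) => //; exists i.
Qed.

Lemma mul_supr (I : Type) (F : I -> Q) b :
  b ⊗ (⋁_x (F x)) = ⋁_x (b ⊗ F x).
Proof.
rewrite qmul_supr; congr qsup; apply/seteqP; split => [_ [_ [i _ <-] <-]|_ [i _ <-]].
  by exists i.
by exists (F i) => //; exists i.
Qed.

Lemma sup_pair b c : b <= c -> qsup [set b; c] = c.
Proof.
move=> bc; apply/le_anti/andP; split; first by apply: qsup_le => a [] ->.
by apply: qsup_ub; right.
Qed.

Lemma qmul_lel a b c : a <= b -> a ⊗ c <= b ⊗ c.
Proof.
move=> ab; rewrite -(sup_pair ab) qmul_supl.
by apply: qsup_ub; exists a => //; left.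
Qed.

Lemma qmul_ler a b c : a <= b -> c ⊗ a <= c ⊗ b.
Proof.
move=> ab; rewrite -(sup_pair ab) qmul_supr.
by apply: qsup_ub; exists a => //; left.
Qed.

Lemma qmul_le a b a' b' : a <= a' -> b <= b' -> a ⊗ b <= a' ⊗ b'.
Proof. by move=> h k; apply: le_trans (qmul_lel _ h) (qmul_ler _ k). Qed.

End QuantaleTheory.

Record category := Category {
  obj :> Type;
  hom : obj -> obj -> Type;
  idc : forall a, hom a a;
  compose : forall a b c, hom b c -> hom a b -> hom a c;
  compose_idl : forall a b (f : hom a b), compose (idc b) f = f;
  compose_idr : forall a b (f : hom a b), compose f (idc a) = f;
  composeA : forall a b c e (h : hom c e) (g : hom b c) (f : hom a b),
    compose h (compose g f) = compose (compose h g) f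
}.
Arguments hom {c} _ _ : rename.
Arguments idc {c} a : rename.
Arguments compose {c a b c0} _ _ : rename.

Record functor (C D : category) := Functor {
  fobj :> C -> D;
  fmap : forall a b : C, hom a b -> hom (fobj a) (fobj b);
  fmap_id : forall a, fmap (idc a) = idc (fobj a);
  fmap_comp : forall a b c (g : hom b c) (f : hom a b),
    fmap (compose g f) = compose (fmap g) (fmap f)
}.
Arguments fmap {C D} _ {a b} _.

Record nat_trans (C D : category) (F G : functor C D) := NatTrans {
  component :> forall a : C, hom (F a) (G a);
  naturality : forall (a b : C) (f : hom a b),
    compose (component b) (fmap F f) = compose (fmap G f) (component a)
}.

Definition is_iso (C : category) (a b : C) (f : hom a b) : Prop :=
  exists g : hom b a, compose g f = idc a /\ compose f g = idc b.

(* The componentwise inverses form a natural transformation automatically. *)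
Definition naturally_isomorphic (C D : category) (F G : functor C D) : Prop :=
  exists eta : nat_trans F G, forall a, is_iso (eta a).

Definition comp_functor (C D E : category)
    (G : functor D E) (F : functor C D) : functor C E.
Proof.
refine (@Functor C E (fun a => G (F a)) (fun a b f => fmap G (fmap F f)) _ _).
  abstract by move=> *; rewrite !fmap_id.
abstract by move=> *; rewrite !fmap_comp.
Defined.

Definition op (C : category) : category :=
  @Category C (fun a b => @hom C b a) (fun a => idc a)
    (fun a b c g f => compose f g)
    (fun a b f => compose_idr f) (fun a b f => compose_idl f)
    (fun a b c e h g f => esym (composeA f g h)).

Definition op_functor (C D : category) (F : functor C D) :
    functor (op C) (op D) :=
  @Functor (op C) (op D) F (fun a b (f : @hom C b a) => fmap F f)
    (fun a => fmap_id F a) (fun a b c g f => fmap_comp F f g).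

Definition type_category : category :=
  @Category Type (fun A B => A -> B) (fun A => id)
    (fun A B C g f => fun x => g (f x))
    (fun A B f => erefl) (fun A B f => erefl)
    (fun A B C E h g f => erefl).

Definition presheaf (C : category) := functor (op C) type_category.

Definition hom_presheaf (C : category) (x : C) : presheaf C.
Proof.
refine (@Functor (op C) type_category (fun a => @hom C a x)
    (fun a b (f : @hom C b a) => fun g : @hom C a x => compose g f) _ _).
  abstract by move=> a; apply/funext => g; exact: compose_idr.
abstract by move=> a b c g f; apply/funext => h; exact: composeA.
Defined.

Record full_obj (C : category) (P : C -> Prop) := FullObj {
  full_val :> obj C;
  full_prop : P full_val
}.

Definition full_subcategory (C : category) (P : C -> Prop) : category :=
  @Category (full_obj P) (fun a b => @hom C a b) (fun a => @idc C a)
    (fun a b c g f => compose g f)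
    (fun a b f => compose_idl f) (fun a b f => compose_idr f)
    (fun a b c e h g f => composeA h g f).

Definition full_inclusion (C : category) (P : C -> Prop) :
    functor (full_subcategory P) C :=
  @Functor (full_subcategory P) C (@full_val C P) (fun a b f => f)
    (fun a => erefl) (fun a b c g f => erefl).

Record qset d (Q : quantaleType d) := QSet {
  qcarrier :> Type;
  delta : qcarrier -> qcarrier -> Q;
  delta_sym : forall x y, delta x y = delta y x;
  delta_trans : forall x y z, delta x y ⊗ delta y z <= delta x z;
  delta_extent : forall x y, delta x x ⊗ delta x y = delta x y
}.
Arguments delta {d Q q} _ _ : rename.

Definition extent d (Q : quantaleType d) (X : qset Q) (x : X) : Q :=
  delta x x.

Record functional_morphism d (Q : quantaleType d) (X Y : qset Q) :=
  FunctionalMorphism {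
  fm_fun :> X -> Y;
  fm_delta : forall x x', delta x x' <= delta (fm_fun x) (fm_fun x');
  fm_extent : forall x, extent (fm_fun x) = extent x
}.

Lemma functional_morphism_ext d (Q : quantaleType d) (X Y : qset Q)
  (f g : functional_morphism X Y) : (forall x, f x = g x) -> f = g.
Proof.
case: f g => f f1 f2 [g g1 g2] /= /funext fg; subst g.
by congr FunctionalMorphism; exact: Prop_irrelevance.
Qed.

Definition fm_id d (Q : quantaleType d) (X : qset Q) :
    functional_morphism X X :=
  @FunctionalMorphism d Q X X id (fun x x' => lexx _) (fun x => erefl).

Definition fm_comp d (Q : quantaleType d) (X Y Z : qset Q)
    (g : functional_morphism Y Z) (f : functional_morphism X Y) :
    functional_morphism X Z.
Proof.
refine (@FunctionalMorphism d Q X Z (fun x => g (f x)) _ _).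
  abstract by move=> x x'; apply: le_trans (fm_delta f x x') (fm_delta g _ _).
abstract by move=> x; rewrite !fm_extent.
Defined.

Definition QSetf d (Q : quantaleType d) : category.
Proof.
refine (@Category (qset Q) (@functional_morphism d Q) (@fm_id d Q)
  (@fm_comp d Q) _ _ _); abstract by move=> *; exact: functional_morphism_ext.
Defined.

Record is_singleton d (Q : quantaleType d) (X : qset Q) (s : X -> Q) : Prop :=
  IsSingleton {
  singleton_extent : forall x, s x ⊗ extent x = s x;
  singleton_delta : forall x y, s x ⊗ delta x y <= s y;
  singleton_mul : forall x y, s x ⊗ s y <= delta x y;
  singleton_sup : forall x, s x ⊗ (⋁_y (s y)) = s x
}.

Definition represents d (Q : quantaleType d) (X : qset Q) (x : X)
  (s : X -> Q) : Prop := forall y, s y = delta y x.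

Definition scott_complete d (Q : quantaleType d) (X : qset Q) : Prop :=
  forall s : X -> Q, is_singleton s -> exists! x : X, represents x s.

Definition ScottQSet d (Q : quantaleType d) : category :=
  @full_subcategory (QSetf Q) (@scott_complete d Q).

Definition scott_inclusion d (Q : quantaleType d) :
    functor (ScottQSet Q) (QSetf Q) :=
  @full_inclusion (QSetf Q) (@scott_complete d Q).

Record singleton d (Q : quantaleType d) (X : qset Q) := Singleton {
  singleton_fun :> X -> Q;
  singletonP : is_singleton singleton_fun
}.

Lemma singleton_ext d (Q : quantaleType d) (X : qset Q) (s t : singleton X) :
  (forall x, s x = t x) -> s = t.
Proof.
case: s t => s s1 [t t1] /= /funext st; subst t.
by congr Singleton; exact: Prop_irrelevance.
Qed.

Section ScottCompletion.
Context d (Q : quantaleType d).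
Hypothesis Qcomm : commutative_quantale Q.
Hypothesis Qsemi : semicartesian_quantale Q.
Hypothesis Qstrong : strong_quantale Q.

Let mulCA (a b c : Q) : a ⊗ (b ⊗ c) = b ⊗ (a ⊗ c).
Proof. by rewrite qmulA (Qcomm a) -qmulA. Qed.

Let mulAC (a b c : Q) : a ⊗ b ⊗ c = a ⊗ c ⊗ b.
Proof. by rewrite -!qmulA (Qcomm b). Qed.

Let mulACA (a b c e : Q) : a ⊗ b ⊗ (c ⊗ e) = a ⊗ c ⊗ (b ⊗ e).
Proof. by rewrite -!qmulA (mulCA b). Qed.

Let mul_lel (a b : Q) : a ⊗ b <= a.
Proof. by apply: le_trans (Qsemi a b) _; exact: leIl. Qed.

Let mul_ler (a b : Q) : a ⊗ b <= b.
Proof. by apply: le_trans (Qsemi a b) _; exact: leIr. Qed.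

Let delta_extentr (X : qset Q) (x y : X) : delta x y ⊗ extent y = delta x y.
Proof. by rewrite Qcomm delta_sym delta_extent. Qed.

(* The Q-valued equality of the Scott completion. *)
Definition singleton_eq (X : qset Q) (s t : singleton X) : Q :=
  ⋁_x (s x ⊗ t x).

Lemma singleton_eq_extent (X : qset Q) (s : singleton X) :
  singleton_eq s s = ⋁_x (s x).
Proof.
apply/le_anti/andP; split.
  by apply: sup_le => x; apply: le_trans (mul_lel _ _) (sup_ub _ x).
have e : ⋁_x (s x) = (⋁_x (s x)) ⊗ (⋁_x (s x)).
  rewrite mul_supl; apply: eq_sup => x; symmetry.
  exact: (singleton_sup (singletonP s)).
apply: le_trans (Qstrong e (lexx _)) _.
by apply: qsup_le => _ [_ [x _ <-] <-]; exact: (sup_ub (fun x => s x ⊗ s x) x).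
Qed.

Lemma singleton_eq_sym (X : qset Q) (s t : singleton X) :
  singleton_eq s t = singleton_eq t s.
Proof. by apply: eq_sup => x; exact: Qcomm. Qed.

Lemma singleton_eq_trans (X : qset Q) (s t u : singleton X) :
  singleton_eq s t ⊗ singleton_eq t u <= singleton_eq s u.
Proof.
rewrite /singleton_eq mul_supl; apply: sup_le => x.
rewrite mul_supr; apply: sup_le => y.
apply: le_trans (sup_ub _ y).
rewrite -qmulA (qmulA (t x)) qmulA.
apply: qmul_lel.
apply: le_trans (singleton_delta (singletonP s) x y).
by apply: qmul_ler; exact: (singleton_mul (singletonP t)).
Qed.

Lemma singleton_eq_ext (X : qset Q) (s t : singleton X) :
  singleton_eq s s ⊗ singleton_eq s t = singleton_eq s t.
Proof.
rewrite singleton_eq_extent /singleton_eq mul_supr; apply: eq_sup => x.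
by rewrite qmulA (Qcomm _ (s x)) (singleton_sup (singletonP s)).
Qed.

Definition completion (X : qset Q) : qset Q :=
  @QSet d Q (singleton X) (@singleton_eq X) (@singleton_eq_sym X)
    (@singleton_eq_trans X) (@singleton_eq_ext X).

Lemma delta_singletonP (X : qset Q) (x : X) :
  is_singleton (fun y => delta y x).
Proof.
split=> [y|y z|y z|y].
- by rewrite Qcomm delta_extent.
- by rewrite Qcomm (delta_sym y z); exact: delta_trans.
- by rewrite (delta_sym z x); exact: delta_trans.
apply/le_anti/andP; split; first exact: mul_lel.
rewrite -{1}(delta_extentr y x); apply: qmul_ler.
exact: (sup_ub (fun y => delta y x) x).
Qed.

Definition delta_singleton (X : qset Q) (x : X) : completion X :=
  Singleton (delta_singletonP x).

Lemma delta_singletonE (X : qset Q) (s : completion X) (x : X) :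
  delta s (delta_singleton x) = s x.
Proof.
apply/le_anti/andP; split.
  by apply: sup_le => y; exact: (singleton_delta (singletonP s)).
rewrite -{1}(singleton_extent (singletonP s) x).
exact: (sup_ub (fun y => s y ⊗ delta y x) x).
Qed.

Lemma completion_scott_complete (X : qset Q) : scott_complete (completion X).
Proof.
move=> S [S1 S2 S3 S4].
have Sx (t : completion X) x : S t ⊗ t x <= S (delta_singleton x).
  by rewrite -(delta_singletonE t x); exact: S2.
have St (t : completion X) : S t = ⋁_x (S t ⊗ t x ⊗ t x).
  rewrite -{1}(S1 t) mul_supr; apply: eq_sup => x; exact: qmulA.
have sP : is_singleton (fun x : X => S (delta_singleton x)).
  split=> [x|x y|x y|x].
  - rewrite -[RHS]S1; congr (_ ⊗ _).
    by rewrite [RHS]delta_singletonE.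
  - by apply: le_trans (Sx (delta_singleton x) y); rewrite /= (delta_sym x y).
  - by apply: le_trans (S3 (delta_singleton x) (delta_singleton y)) _; rewrite delta_singletonE /= delta_sym.
  - rewrite -[RHS]S4; congr (_ ⊗ _); apply/le_anti/andP; split.
      by apply: sup_le => y; exact: (sup_ub S).
    apply: sup_le => t; rewrite St; apply: sup_le => y.
    apply: le_trans (mul_lel _ _) _; apply: le_trans (Sx t y) _.
    exact: (sup_ub (fun y => S (delta_singleton y)) y).
exists (Singleton sP : completion X); split.
- move=> t; apply/le_anti/andP; split.
    rewrite St; apply: sup_le => x.
    apply: le_trans (qmul_lel _ (Sx t x)) _; rewrite Qcomm.
    exact: (sup_ub (fun x => t x ⊗ S (delta_singleton x)) x).
  apply: sup_le => x /=.
  by rewrite -(delta_singletonE t x) Qcomm delta_sym; exact: S2.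
- move=> s' hs'; apply: singleton_ext => x /=.
  by rewrite hs' delta_sym delta_singletonE.
Qed.

Section CompletionMap.
Context (X Y : qset Q) (f : functional_morphism X Y).

Definition completion_fun (s : X -> Q) : Y -> Q :=
  fun y => ⋁_x (delta (f x) y ⊗ s x).

Let extent_mul (s : singleton X) x : delta (f x) (f x) ⊗ s x = s x.
Proof.
have := fm_extent f x; rewrite /extent => ->.
by rewrite Qcomm; exact: (singleton_extent (singletonP s)).
Qed.

Let completion_sup (s : singleton X) :
  ⋁_y (completion_fun s y) = ⋁_x (s x).
Proof.
apply/le_anti/andP; split.
  apply: sup_le => y; apply: sup_le => x.
  by apply: le_trans (mul_ler _ _) (sup_ub _ x).
apply: sup_le => x; apply: le_trans (sup_ub (completion_fun s) (f x)).
rewrite -{1}(extent_mul s x).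
exact: (sup_ub (fun x' => delta (f x') (f x) ⊗ s x') x).
Qed.

Lemma completion_funP (s : singleton X) : is_singleton (completion_fun s).
Proof.
split=> [y|y z|y z|y].
- rewrite mul_supl; apply: eq_sup => x.
  by rewrite mulAC delta_extentr.
- rewrite mul_supl; apply: sup_le => x.
  apply: le_trans (sup_ub _ x); rewrite mulAC.
  by apply: qmul_lel; exact: delta_trans.
- rewrite mul_supl; apply: sup_le => x.
  rewrite mul_supr; apply: sup_le => x'.
  rewrite mulACA.
  apply: le_trans (qmul_ler _ (singleton_mul (singletonP s) x x')) _.
  apply: le_trans (qmul_ler _ (fm_delta f x x')) _.
  rewrite mulAC (delta_sym (f x) y).
  apply: le_trans (qmul_lel _ (delta_trans _ _ _)) _.
  exact: delta_trans.
- rewrite completion_sup mul_supl; apply: eq_sup => x.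
  by rewrite -qmulA (singleton_sup (singletonP s)).
Qed.

Definition completion_map_fun (s : completion X) : completion Y :=
  Singleton (completion_funP s).

Lemma completion_map_delta (s t : completion X) :
  delta s t <= delta (completion_map_fun s) (completion_map_fun t).
Proof.
apply: sup_le => x.
apply: le_trans (sup_ub (fun y => completion_fun s y ⊗ completion_fun t y) (f x)).
apply: qmul_le.
- rewrite -{1}(extent_mul s x).
  exact: (sup_ub (fun x' => delta (f x') (f x) ⊗ s x') x).
- rewrite -{1}(extent_mul t x).
  exact: (sup_ub (fun x' => delta (f x') (f x) ⊗ t x') x).
Qed.

Lemma completion_map_extent (s : completion X) :
  extent (completion_map_fun s) = extent s.
Proof.
rewrite /extent [LHS]singleton_eq_extent [RHS]singleton_eq_extent.
exact: completion_sup.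
Qed.

Definition completion_map :
    functional_morphism (completion X) (completion Y) :=
  FunctionalMorphism completion_map_delta completion_map_extent.

End CompletionMap.

Lemma completion_map_id (X : qset Q) :
  completion_map (fm_id X) = fm_id (completion X).
Proof.
apply: functional_morphism_ext => s; apply: singleton_ext => y /=.
apply/le_anti/andP; split.
  apply: sup_le => x; rewrite Qcomm.
  exact: (singleton_delta (singletonP s)).
rewrite -{1}(singleton_extent (singletonP s) y) Qcomm.
exact: (sup_ub (fun x => delta x y ⊗ s x) y).
Qed.

Lemma completion_map_comp (X Y Z : qset Q)
    (g : functional_morphism Y Z) (f : functional_morphism X Y) :
  completion_map (fm_comp g f) = fm_comp (completion_map g) (completion_map f).
Proof.
apply: functional_morphism_ext => s; apply: singleton_ext => z /=.
apply/le_anti/andP; split; apply: sup_le => x /=.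
- apply: le_trans (sup_ub (fun y => delta (g y) z ⊗ completion_fun f s y) (f x)).
  apply: qmul_ler.
  rewrite -{1}(singleton_extent (singletonP s) x) Qcomm -(fm_extent f).
  exact: (sup_ub (fun x' => delta (f x') (f x) ⊗ s x') x).
- rewrite mul_supr; apply: sup_le => y /=.
  apply: le_trans (sup_ub (fun x => delta (g (f x)) z ⊗ s x) y).
  rewrite qmulA; apply: qmul_lel.
  apply: le_trans (qmul_ler _ (fm_delta g _ _)) _.
  by rewrite Qcomm; exact: delta_trans.
Qed.

Definition scott_completion : functor (QSetf Q) (ScottQSet Q) :=
  @Functor (QSetf Q) (ScottQSet Q)
    (fun X => @FullObj (QSetf Q) (@scott_complete d Q) (completion X)
       (@completion_scott_complete X))
    (fun X Y f => completion_map f)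
    completion_map_id
    (fun X Y Z g f => completion_map_comp g f).

End ScottCompletion.

(* Main.v *)
Require Import Defs.
From mathcomp Require Import all_boot all_order.
From mathcomp Require Import boolp.

(** Let η be the embedding of a Q-set in its Scott completion that sends a point
    to the singleton it represents, and write 𝔖 for the completion.  Singletons
    are dense: a morphism g from 𝔖(Y) to Z is determined by its composite with
    η, because δ(z, g s) is the supremum of the δ(g(η y), z) ⊗ s(y).  In terms
    of the functor this reads 𝔖(g ∘ η) = η ∘ g ([completion_map_scott_unit]).
    Consequently a retraction r of η : X → 𝔖(X) is automatically an inverse,
    since η ∘ r = 𝔖(r ∘ η) = id, and such an r exists exactly when X is
    Scott-complete: r picks the representing element
    ([scott_completeP_retraction]).

    If X is Scott-complete, f ↦ r ∘ 𝔖(f) is natural in f, and its inverse is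
    precomposition with η.

    Conversely, let φ be any natural isomorphism; it need not come from η.
    Density for g = id gives 𝔖(η_X) = η_𝔖(X), and 𝔖(X) is complete, so 𝔖(η_X)
    has a retraction μ.  Choose h : 𝔖(X) → X with φ(h) = φ(id_X) ∘ μ.
    Naturality of φ along η_X gives
    φ(h ∘ η_X) = φ(h) ∘ 𝔖(η_X) = φ(id_X) ∘ μ ∘ 𝔖(η_X) = φ(id_X),
    hence h ∘ η_X = id_X, which makes X Scott-complete. *)

Section ScottUnit.
Set Implicit Arguments.
Unset Strict Implicit.
Unset Printing Implicit Defensive.
Import Order.TTheory.
Local Open Scope order_scope.

Context d (Q : quantaleType d).
Context (Qcomm : commutative_quantale Q).
Context (Qsemi : semicartesian_quantale Q).
Context (Qstrong : strong_quantale Q).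

Notation "'𝔖' X" := (completion Qcomm Qsemi Qstrong X) (at level 9).
Notation "'𝔖map' f" := (completion_map Qcomm Qsemi Qstrong f) (at level 9).
Notation "g ∘ f" := (fm_comp g f) (at level 40, left associativity).

Lemma delta_delta_singleton (X : qset Q) (x y : X) :
  delta (delta_singleton Qcomm Qsemi Qstrong x : 𝔖 X)
    (delta_singleton Qcomm Qsemi Qstrong y) = delta x y.
Proof. by rewrite delta_singletonE /= delta_sym. Qed.

Definition scott_unit (X : qset Q) : functional_morphism X (𝔖 X).
Proof.
refine (@FunctionalMorphism d Q X (𝔖 X) (@delta_singleton d Q Qcomm Qsemi Qstrong X) _ _).
  abstract by move=> x y; rewrite delta_delta_singleton.
abstract by move=> x; rewrite /extent delta_delta_singleton.
Defined.

Lemma represents_scott_unit (X : qset Q) (s : 𝔖 X) (x : X) :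
  represents x s <-> scott_unit X x = s.
Proof.
split=> [xs | <- //].
by apply: singleton_ext => y /=; rewrite xs.
Qed.

Lemma scott_unit_natural (X Y : qset Q) (f : functional_morphism X Y) :
  𝔖map f ∘ scott_unit X = scott_unit Y ∘ f.
Proof.
apply: functional_morphism_ext => x; apply: singleton_ext => y /=.
apply/le_anti/andP; split.
  apply: sup_le => x'; rewrite Qcomm (delta_sym x') (delta_sym y).
  by apply: le_trans (qmul_lel _ (fm_delta f x x')) _; exact: delta_trans.
rewrite delta_sym -delta_extent.
have -> : delta (f x) (f x) = delta x x by exact: fm_extent.
by rewrite Qcomm; exact: (sup_ub (fun x' => delta (f x') y ⊗ delta x' x) x).
Qed.

(** Density of the points among the singletons.  One inequality uses that g
    preserves the extent of s, which is the supremum of the s(y) ⊗ s(y). *)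
Lemma completion_map_scott_unit (Y Z : qset Q)
    (g : functional_morphism (𝔖 Y) Z) :
  𝔖map (g ∘ scott_unit Y) = scott_unit Z ∘ g.
Proof.
apply: functional_morphism_ext => s; apply: singleton_ext => z /=.
have s_le y : s y <= delta (g s) (g (scott_unit Y y)).
  by apply: le_trans (fm_delta g _ _); rewrite delta_singletonE.
apply/le_anti/andP; split.
  apply: sup_le => y; apply: le_trans (qmul_ler _ (s_le y)) _.
  by rewrite Qcomm (delta_sym z); exact: delta_trans.
rewrite delta_sym -delta_extent.
have -> : delta (g s) (g s) = delta s s by exact: fm_extent.
rewrite [delta s s]/delta /= mul_supl; apply: sup_le => y.
apply: le_trans (sup_ub _ y); rewrite -qmulA Qcomm; apply: qmul_lel.
apply: le_trans (qmul_lel _ (s_le y)) _.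
by rewrite (delta_sym (g s)); exact: delta_trans.
Qed.

Lemma retraction_scott_unit_inverse (X : qset Q)
    (r : functional_morphism (𝔖 X) X) :
  r ∘ scott_unit X = fm_id X -> scott_unit X ∘ r = fm_id (𝔖 X).
Proof.
by move=> rK; rewrite -completion_map_scott_unit rK completion_map_id.
Qed.

(** The retraction sends a singleton to its representing element; it is a
    morphism because the embedding preserves and reflects δ. *)
Lemma scott_completeP_retraction (X : qset Q) :
  scott_complete X <->
  exists r : functional_morphism (𝔖 X) X, r ∘ scott_unit X = fm_id X.
Proof.
split=> [Xcomplete | [r rK]].
  have [r rP] : exists r : 𝔖 X -> X, forall s, scott_unit X (r s) = s.
    have exr (s : 𝔖 X) : exists x, scott_unit X x = s.
      have [x [/(represents_scott_unit s) xs _]] := Xcomplete s (singletonP s).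
      by exists x.
    by exists (fun s => sval (cid (exr s))) => s; exact: svalP (cid (exr s)).
  have rdelta s t : delta s t = delta (r s) (r t).
    rewrite -[RHS]delta_delta_singleton.
    exact: (congr2 delta (esym (rP s)) (esym (rP t))).
  have rle s t : delta s t <= delta (r s) (r t) by rewrite -rdelta.
  have rext s : extent (r s) = extent s by rewrite /extent -rdelta.
  exists (FunctionalMorphism rle rext).
  apply: functional_morphism_ext => x /=.
  have [y [_ y_uniq]] := Xcomplete _ (singletonP (scott_unit X x)).
  transitivity y; last exact: y_uniq.
  symmetry; apply: y_uniq.
  by apply/(represents_scott_unit (scott_unit X x)); exact: rP.
have rK1 x : r (scott_unit X x) = x.
  exact: (congr1 (fun f : functional_morphism X X => f x) rK).
have Kr s : scott_unit X (r s) = s.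
  exact: (congr1 (fun f : functional_morphism (𝔖 X) (𝔖 X) => f s)
                 (retraction_scott_unit_inverse rK)).
move=> s sP; exists (r (Singleton sP)); split.
  by apply/(represents_scott_unit (Singleton sP)); exact: Kr.
move=> x /(represents_scott_unit (Singleton sP)) <-; exact: rK1.
Qed.

End ScottUnit.

Theorem mainTheorem9 (d : Order.disp_t) (Q : quantaleType d)
    (Qcomm : commutative_quantale Q)
    (Qsemi : semicartesian_quantale Q)
    (Qstrong : strong_quantale Q)
    (X : qset Q) :
  scott_complete X <->
  naturally_isomorphic
    (@hom_presheaf (QSetf Q) X)
    (comp_functor (@hom_presheaf (QSetf Q) X)
       (op_functor
          (comp_functor (scott_inclusion Q)
             (scott_completion Qcomm Qsemi Qstrong)))).
Proof.
set G := comp_functor _ _.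
pose S := completion Qcomm Qsemi Qstrong.
pose Smap := @completion_map d Q Qcomm Qsemi Qstrong.
pose eta := @scott_unit d Q Qcomm Qsemi Qstrong.
have compA := @composeA (QSetf Q).
have idl := @compose_idl (QSetf Q).
have idr := @compose_idr (QSetf Q).
split.
  move=> /(scott_completeP_retraction Qcomm Qsemi Qstrong) [r rK].
  have ext_natural (Y Z : qset Q) (f : functional_morphism Z Y) :
      (fun g => fm_comp r (Smap Z X (fm_comp g f))) =
      (fun g => fm_comp (fm_comp r (Smap Y X g)) (Smap Z Y f)).
    apply: funext => g.
    by rewrite /Smap completion_map_comp; exact: compA.
  exists (@NatTrans _ _ (@hom_presheaf (QSetf Q) X) G
           (fun Y (f : functional_morphism Y X) => fm_comp r (Smap Y X f))
           ext_natural).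
  move=> Y; exists (fun g : functional_morphism (S Y) X => fm_comp g (eta Y)).
  split; apply: funext => f /=.
    rewrite -[LHS]compA /= [X in fm_comp r X]scott_unit_natural.
    by rewrite [LHS]compA /= [X in fm_comp X f]rK; exact: idl.
  rewrite [X in fm_comp r X]completion_map_scott_unit.
  by rewrite [LHS]compA /= [X in fm_comp X f]rK; exact: idl.
move=> [phi phi_iso]; apply/(scott_completeP_retraction Qcomm Qsemi Qstrong).
(* Density for the identity of 𝔖(X), and a retraction of η at 𝔖(X). *)
have unit_map : Smap _ _ (eta X) = eta (S X).
  have := @completion_map_scott_unit _ _ Qcomm Qsemi Qstrong X (S X) (fm_id _).
  by rewrite [X in completion_map _ _ _ X]idl [RHS]idr.
have [mu muK] : exists mu, fm_comp mu (eta (S X)) = fm_id (S X).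
  apply/(scott_completeP_retraction Qcomm Qsemi Qstrong).
  exact: completion_scott_complete.
have [psi [_ phiK]] := phi_iso (S X : QSetf Q).
have [psiX [psiXK _]] := phi_iso (X : QSetf Q).
(* The retraction h of η_X is the one with φ(h) = φ(id_X) ∘ μ. *)
exists (psi (fm_comp (phi X (fm_id X)) mu)).
have phi_inj f g : phi X f = phi X g -> f = g.
  move=> /(congr1 psiX); have K h := congr1 (fun F => F h) psiXK.
  by rewrite [LHS]K [RHS]K.
apply: phi_inj.
have nat_eta := naturality phi (eta X : @hom (QSetf Q) X (S X)).
rewrite [LHS](congr1 (fun F => F (psi (fm_comp (phi X (fm_id X)) mu))) nat_eta).
rewrite /= [X in fm_comp X _](congr1 (fun F => F _) phiK).
rewrite [X in fm_comp _ X]unit_map -[LHS]compA /= [X in fm_comp _ X]muK.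
exact: idr.
Qed.
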